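(* Let $P$ be a ranked poset of rank $n$ with minimum $\hat0$ and maximum $\hat1$, equipped with a local action of $S_n$ on its set $\mathcal{M}(P)$ of maximal chains. (a) For every $c\in\mathcal{M}(P)$, the stabilizer of $c$ is a Young subgroup $S_{B_1}\times S_{B_2}\times\cdots\times S_{B_k}$ of $S_n$, where $\{B_1,\dots,B_k\}$ is a partition of the set $[n]$ and $S_{B}$ denotes the group of permutations of $[n]$ fixing every element outside $B$. (b) If $\psi$ is the character of the corresponding permutation representation of $S_n$ on $\mathbf{C}\mathcal{M}(P)$, then $\mathrm{ch}(\psi)$ is $h$-positive, i.e., $\mathrm{ch}(\psi)=\sum_{\nu\vdash n}a_\nu h_\nu$ with all $a_\nu\ge 0$. (c) If $\mathrm{ch}(\psi)=h_\nu$ for some partition $\nu=(\nu_1,\nu_2,\dots)\vdash n$, then $P\cong C_{\nu_1+1}\times C_{\nu_2+1}\times\cdots$.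
   Context: A local action of $S_n$ on $\mathcal{M}(P)$ is an action of $S_n$ on the set $\mathcal{M}(P)$ such that for each adjacent transposition $\sigma_i=(i,i+1)$, $1\le i\le n-1$, and each maximal chain $m$, the chain $\sigma_i(m)$ differs from $m$ at most in the element of rank $i$. $\mathrm{ch}$ denotes the Frobenius characteristic map from class functions of $S_n$ to symmetric functions of degree $n$; $h_\nu=h_{\nu_1}h_{\nu_2}\cdots$ is the complete homogeneous symmetric function. $C_i$ denotes a chain with $i$ elements. *)

(* Defs.v *)
From HB Require Import structures.
From mathcomp Require Import all_boot all_order all_algebra all_fingroup.
From mathcomp Require Import mpoly.
Set Implicit Arguments. Unset Strict Implicit. Unset Printing Implicit Defensive.
Import Order.TTheory GRing.Theory.

Local Open Scope order_scope.

Section Posets.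
Context {d : Order.disp_t} (P : finPOrderType d).

Definition covers (x y : P) : bool :=
  (x < y) && [forall z : P, ~~ ((x < z) && (z < y))].

Definition is_chain (C : {set P}) : bool :=
  [forall x in C, forall y in C, (x <= y) || (y <= x)].

Definition is_maxchain (C : {set P}) : bool :=
  is_chain C && [forall D : {set P}, (is_chain D && (C \subset D)) ==> (D == C)].

Definition maxchains := {C : {set P} | is_maxchain C}.

Definition ranked_of_rank (n : nat) (bot top : P) (rk : P -> nat) : Prop :=
  [/\ forall x, bot <= x, forall x, x <= top,
      rk bot = 0%N, rk top = n & forall x y, covers x y -> rk y = (rk x).+1].

(* A local action of S_n on M(P): for the adjacent transposition
   sigma_i = (i, i+1) of [n] (here the ordinals i-1, i of 'I_n), the chains
   c and sigma_i(c) agree except possibly in their element of rank i. *)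
Definition local_action (n : nat) (rk : P -> nat)
    (to : {action {perm 'I_n} &-> maxchains}) : Prop :=
  forall (i j : 'I_n), val j = (val i).+1 ->
  forall c : maxchains,
    [set x in val (to c (tperm i j)) | rk x != val j] =
    [set x in val c | rk x != val j].

End Posets.

Definition young_subgroup (n : nat) (B : {set {set 'I_n}}) : {set {perm 'I_n}} :=
  (\prod_(b in B) Sym b)%g.

(* permutation character: psi(w) = trace of w on C M(P) = number of fixed chains *)
Definition perm_char (n : nat) (T : finType) (to : {action {perm 'I_n} &-> T})
    (w : {perm 'I_n}) : nat := #|('Fix_to[w])%g|.

(* Symmetric functions of degree n, realized in n variables over Q
   (restriction Lambda^n -> Lambda_n^n is an isomorphism). *)
Local Open Scope ring_scope.

Definition power_sum (n k : nat) : {mpoly rat[n]} := \sum_(i < n) 'X_i ^+ k.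

Definition power_sum_cycle (n : nat) (w : {perm 'I_n}) : {mpoly rat[n]} :=
  \prod_(C in porbits w) power_sum n #|C|.

Definition frob_ch (n : nat) (chi : {perm 'I_n} -> rat) : {mpoly rat[n]} :=
  (n`!%:R)^-1 *: \sum_(w : {perm 'I_n}) chi w *: power_sum_cycle w.

Definition hcomplete (n k : nat) : {mpoly rat[n]} :=
  \sum_(m : 'X_{1..n < k.+1} | mdeg (val m) == k) 'X_[val m].

Definition hprod (n : nat) (nu : seq nat) : {mpoly rat[n]} :=
  \prod_(k <- nu) hcomplete n k.

Definition is_partition (n : nat) (nu : seq nat) : bool :=
  [&& sorted geq nu, all (fun k => 0 < k)%N nu & sumn nu == n].

Definition h_positive (n : nat) (f : {mpoly rat[n]}) : Prop :=
  exists s : seq (seq nat * rat),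
    [/\ all (fun p => is_partition n p.1) s, uniq (map fst s),
        all (fun p => 0 <= p.2) s &
        f = \sum_(p <- s) p.2 *: hprod n p.1].

Definition chain_product (nu : seq nat) :=
  {dffun forall j : 'I_(size nu), 'I_(nth 0%N nu j).+1}.

Definition iso_to_chain_product {d : Order.disp_t} (P : finPOrderType d)
    (nu : seq nat) : Prop :=
  exists f : P -> chain_product nu,
    bijective f /\
    forall x y : P, (x <= y)%O = [forall j, (f x j <= f y j)%N].

(* Main.v *)
(** For a maximal chain c, the rank-k element of c.w depends only on the set
    w^-1[k], since the permutations preserving [k] are generated by adjacent
    transpositions other than sigma_k.  If h stabilizes c and h(a) = b, then after
    conjugating a to the first letter this forces (a b) to stabilize c, so the
    stabilizer is the full Young subgroup of its orbits on [n].  Summing power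
    sums over a Young subgroup counts pairs (permutation, fixed coloring), and
    orbit counting on colorings yields the product of the h_|B|, whence (b).

    If ch(psi) = h_nu, evaluating at (1, 0, 0, ...) shows that the action is
    transitive, and at (1, q, 0, ...) with q a root of unity that the blocks have
    sizes nu.  Write x = (element of rank k of c.w); the numbers |w^-1[k] n B_j|
    depend only on x: if two chains pass through x, splicing the lower part of
    one with the upper part of the other connects them by permutations fixing
    the letters <= k, respectively > k, up to stabilizers.  These numbers are the
    coordinates of x in the product of chains. *)

Require Import Defs.
From HB Require Import structures.
From mathcomp Require Import all_boot all_order all_algebra all_fingroup all_field.
From mathcomp Require Import mpoly.
From mathcomp Require Import zify.

Set Implicit Arguments. Unset Strict Implicit. Unset Printing Implicit Defensive.
Import Order.TTheory GRing.Theory Num.Theory GroupScope.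

(** * Permutations preserving the fibers of a map *)

Section FiberPreservingPermutations.
Variables (T : finType) (K : eqType) (kappa : T -> K).

(** Induction on the number of moved points: composing with the transposition of [x] and [g x],
    which lie in one fiber, makes [x] fixed and moves no new point. *)
Lemma fiber_perm_ind (Q : {perm T} -> Prop) :
  Q 1 -> (forall g h, Q g -> Q h -> Q (g * h)) ->
  (forall x y, kappa x = kappa y -> Q (tperm x y)) ->
  forall g : {perm T}, (forall x, kappa (g x) = kappa x) -> Q g.
Proof.
move=> Q1 QM Qt g; have [m] := ubnP #|[set x | g x != x]|.
elim: m g => // m IHm g ltm fixg.
have [x gx|g1] := pickP (fun x => g x != x); last first.
  suff -> : g = 1 by [].
  by apply/permP => x; rewrite perm1; apply/eqP; have := g1 x; case: eqP.
pose g' := g * tperm x (g x).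
have g'E y : g' y = if y == x then x else if g y == x then g x else g y.
  rewrite permM; case: (eqVneq y x) => [->|yx]; first by rewrite tpermR.
  case: tpermP => [->||/eqP/negPf->] //; first by rewrite eqxx.
  by move/perm_inj/eqP; rewrite (negPf yx).
have -> : g = g' * tperm x (g x) by rewrite /g' -mulgA tperm2 mulg1.
apply: (QM); last by apply: Qt; rewrite fixg.
apply: IHm => [|y]; last first.
  rewrite g'E; case: (eqVneq y x) => [->//|_].
  by case: eqP => [gy|_]; rewrite fixg // -gy fixg.
rewrite ltnS in ltm; apply: leq_trans ltm; apply: proper_card; apply/properP.
split; last by exists x; rewrite !inE ?gx // g'E !eqxx.
apply/subsetP => y; rewrite !inE g'E.
case: (eqVneq y x) => [->|yx]; first by rewrite eqxx.
by case: (eqVneq (g y) x) => // -> _; rewrite eq_sym.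
Qed.

(** Induction on the size of [A :\: B]: a point of [A] outside [B] is swapped with a point of [B]
    outside [A] in the same fiber. *)
Lemma fiber_perm_subset (A B : {set T}) :
  (forall k, #|[set x in A | kappa x == k]| <= #|[set x in B | kappa x == k]|) ->
  exists2 g : {perm T}, (forall x, kappa (g x) = kappa x) &
    [set g x | x in A] \subset B.
Proof.
have [m] := ubnP #|A :\: B|; elim: m A => // m IHm A ltm leAB.
have [/eqP|[a /setDP[aA aB]]] := set_0Vmem (A :\: B).
  rewrite setD_eq0 => sAB; exists 1 => [x|]; first by rewrite perm1.
  by apply/subsetP => _ /imsetP[x xA ->]; rewrite perm1 (subsetP sAB).
(* Otherwise the part of [B] in the fiber of [a] would lie in that of [A] and miss [a], against the
   count. *)
have [b bB] : exists b, b \in [set x in B | kappa x == kappa a] :\: A.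
  apply/set0Pn; rewrite setD_eq0; apply: contraL (leAB (kappa a)) => sBA.
  rewrite -ltnNge; apply: proper_card; apply/properP; split.
    by apply/subsetP => x xB; rewrite inE (subsetP sBA) //; case/setIdP: xB.
  by exists a; rewrite !inE ?aA ?eqxx // (negPf aB).
case/setDP: bB; rewrite inE => /andP[bB /eqP kba] bA.
have ab : a != b by apply: contraNneq bA => <-.
pose t := tperm a b.
have kt x : kappa (t x) = kappa x by rewrite /t; case: tpermP => [->|->|].
have memtA x : (x \in [set t y | y in A]) = (t x \in A).
  by rewrite -{1}[x](tpermK a b) mem_imset //; apply: perm_inj.
have cardtA k : #|[set x in [set t y | y in A] | kappa x == k]|
              = #|[set x in A | kappa x == k]|.
  rewrite -[RHS](card_imset _ (@perm_inj _ t)); apply: eq_card => x.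
  by rewrite !inE memtA -{3}[x](tpermK a b) mem_imset ?inE ?kt //; apply: perm_inj.
have [||g kg sgB] := IHm [set t y | y in A].
- rewrite ltnS in ltm; apply: leq_trans ltm; apply: proper_card; apply/properP.
  split; last by exists a; rewrite !inE ?aA ?aB // memtA tpermL (negPf bA) andbF.
  apply/subsetP => x; rewrite !inE memtA; case/andP=> xB.
  rewrite /t; case: tpermP => [xa|xb|_ _ xA]; last by rewrite xB.
    by rewrite (negPf bA).
  by move: xB; rewrite xb bB.
- by move=> k; rewrite cardtA.
exists (t * g) => [x|]; first by rewrite permM kg kt.
apply/subsetP => _ /imsetP[x xA ->]; rewrite permM (subsetP sgB) // imset_f //.
by apply: imset_f.
Qed.

End FiberPreservingPermutations.

(** * Local actions *)

Section AbstractLocalAction.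
Variables (M : finType) (X : eqType) (n : nat) (r : nat -> M -> X).
Variable to : {action {perm 'I_n} &-> M}.
Hypothesis local_to : forall i j : 'I_n, val j = (val i).+1 ->
  forall c k, k != val j -> r k (to c (tperm i j)) = r k c.
Hypothesis rank_ext : forall c c', (forall k, r k c = r k c') -> c = c'.

(** Letters start at 0: [x < k] singles out the first k letters, and only the adjacent transposition
    of k-1 and k may change rank k. The others generate all permutations preserving these
    letters. *)
Lemma rank_stable k (g : {perm 'I_n}) c :
  (forall x, (g x < k) = (x < k)) -> r k (to c g) = r k c.
Proof.
move=> gk; have := @fiber_perm_ind _ _ (fun x : 'I_n => x < k)
  (fun g => forall c, r k (to c g) = r k c).
apply => // {c g gk} [c|g h Hg Hh c|x y].
- by rewrite act1.
- by rewrite actM Hh Hg.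
wlog xy : x y / x < y.
  move=> H; case: (ltngtP x y) => [/H//|/H Hyx /esym|/val_inj-> _ c].
    by rewrite tpermC.
  by rewrite tperm1 act1.
have [m] := ubnP (y - x); elim: m x y xy => // m IHm x y xy ltm kxy.
have ltp : y.-1 < n by have := ltn_ord y; lia.
pose z := Ordinal ltp.
have yk : k != y by apply/eqP => ky; move: kxy; rewrite ky xy ltnn.
have [zx|zx] := eqVneq z x.
  move=> c; apply: local_to => //=; rewrite -zx /=; lia.
have xz : x < z by have : val z != val x; [| move=> /= ? ; lia].
have -> : tperm x y = tperm z y * tperm x z * tperm z y.
  have := tpermJ x z (tperm z y); rewrite tpermL tpermD.
  - by move=> <-; rewrite /conjg tpermV mulgA.
  - by apply: contraTneq xz => ->; rewrite ltnn.
  - by apply: contraTneq xy => ->; rewrite ltnn.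
have yz : val y = (val z).+1 by rewrite /=; lia.
have kxz : (x < k) = (z < k) by move: kxy yk => /=; lia.
have ltzm : z - x < m by move: xz ltm => /=; lia.
by move=> c; rewrite !actM (local_to yz) // (IHm _ _ xz ltzm kxz) (local_to yz).
Qed.

Lemma rank_eq k (g h : {perm 'I_n}) c :
  (forall x, (g x < k) = (h x < k)) -> r k (to c g) = r k (to c h).
Proof.
move=> gh; rewrite -[h](mulKVg g) actM; apply/esym/rank_stable => x.
by rewrite permM -gh permKV.
Qed.

(* Conjugate (a b) to the adjacent transposition (k-1 k), which can only move
   the element of rank k. *)
Lemma tperm_fix k (a b : 'I_n) c :
  a < k <= b -> r k (to c (tperm a b)) = r k c -> to c (tperm a b) = c.
Proof.
case/andP=> ak kb rk.
have ltk : k < n by have := ltn_ord b; lia.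
have ltp : k.-1 < n by lia.
pose i := Ordinal ltp; pose j := Ordinal ltk.
pose u := tperm a i * tperm b j.
have ua : u a = i.
  by rewrite permM tpermL tpermD // -val_eqE /=; lia.
have ub : u b = j.
  rewrite permM (@tpermD _ a i b) ?tpermL // -val_eqE /=; lia.
have uk x : (u x < k) = (x < k).
  have tk (p q y : 'I_n) : (p < k) = (q < k) -> (tperm p q y < k) = (y < k).
    by case: tpermP => [->|->|].
  by rewrite permM !tk //=; lia.
have uE : u * tperm i j * u^-1 = tperm a b.
  by apply: (mulIg u); rewrite mulgKV conjgC tpermJ ua ub.
(* Locality settles the ranks other than k. At rank k, [u] preserves the first k letters, so the
   hypothesis on (a b) applies. *)
have H : to c (u * tperm i j) = to c u.
  apply: rank_ext => l; have [->|kl] := eqVneq l k; last first.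
    by rewrite actM local_to //=; lia.
  rewrite (rank_stable _ uk) -rk; apply: rank_eq => x.
  have -> : u * tperm i j = tperm a b * u by rewrite -uE mulgKV.
  by rewrite permM uk.
by rewrite -uE actM H -actM mulgV act1.
Qed.

(** Let [u] carry [a] to the first letter [o]. Then [h * u * tperm o (u b)] and [u] both send [a] to
    [o], so the conjugated transposition preserves the element of rank 1 of c.u, and [tperm_fix]
    applies at rank 1. *)
Lemma tperm_stab c h (a b : 'I_n) : to c h = c -> h a = b -> to c (tperm a b) = c.
Proof.
move=> hc hab.
have n0 : 0 < n by have := ltn_ord a; lia.
pose o := Ordinal n0; pose u := tperm a o.
have ua : u a = o by rewrite tpermL.
have [ab|ab] := eqVneq a b; first by rewrite -ab tperm1 act1.
have uE : u * tperm o (u b) * u^-1 = tperm a b.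
  by apply: (mulIg u); rewrite mulgKV conjgC tpermJ ua.
have lt1 (x : 'I_n) : (x < 1) = (x == o) by rewrite -val_eqE /=; lia.
rewrite -uE actM actM; have -> : to (to c u) (tperm o (u b)) = to c u.
  apply: (@tperm_fix 1) => /=.
    rewrite lt0n; apply: contraNneq ab => ub0; apply/eqP/(@perm_inj _ u).
    by rewrite ua; apply: val_inj; rewrite /= ub0.
  rewrite -{1}hc -!actM; apply: rank_eq => x; rewrite !lt1.
  have E : (h * u * tperm o (u b)) a = o by rewrite !permM hab tpermR.
  have xE (g : {perm 'I_n}) : g a = o -> (g x == o) = (x == a).
    by move=> <-; rewrite (inj_eq perm_inj).
  by rewrite mulgA !xE.
by rewrite -actM mulgV act1.
Qed.

(** Each step of the induction puts a transposition stabilizing [c] in front of the permutation: one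
    more letter becomes fixed and the final chain is unchanged. *)
Lemma agree_below c v k : k <= n -> (forall j, j <= k -> r j (to c v) = r j c) ->
  exists2 w : {perm 'I_n}, (forall x : 'I_n, x < k -> w x = x) & to c w = to c v.
Proof.
elim: k => [_ _|k IHk ltk Hr]; first by exists v.
have [|j jk|w wk cw] := IHk; [exact: ltnW | by apply: Hr; apply: leqW |].
pose o := Ordinal ltk; pose b := w^-1 o; have wb : w b = o by rewrite permKV.
have wlt x : (w x < k) = (x < k).
  apply/idP/idP => [wx|xk]; last by rewrite wk.
  by rewrite -(perm_inj (wk _ wx)).
have kb : k <= b by rewrite leqNgt -wlt wb ltnn.
(* [w] and (o b) pull the first k+1 letters back to the same set, so c.(o b) has the element of rank
   k+1 of c.w, which is that of [c]. *)
have fixb : to c (tperm o b) = c.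
  have [<-|ob] := eqVneq o b; first by rewrite tperm1 act1.
  have kneb : k != b by [].
  apply: (@tperm_fix k.+1); first by rewrite /= ltnS leqnn /=; lia.
  rewrite -[RHS]Hr // -cw; apply: rank_eq => x; rewrite [RHS]ltnS [RHS]leq_eqVlt wlt.
  have -> : (val (w x) == k) = (x == b) by rewrite -(inj_eq (@perm_inj _ w)) wb.
  case: tpermP => [->|->|/eqP xo /eqP xb] /=; rewrite ?eqxx ?leqnn //.
    by rewrite (negPf ob) ltnn; apply/negbTE; lia.
  rewrite (negPf xb) /=; move: xo; rewrite -val_eqE /=; lia.
exists (tperm o b * w) => [x|]; last by rewrite actM fixb.
rewrite ltnS leq_eqVlt permM => /orP[/eqP xk|xk].
  by rewrite (_ : x = o) ?tpermL //; apply: val_inj.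
by rewrite tpermD ?wk // -val_eqE /= neq_ltn ?xk ?orbT // (leq_trans xk kb) orbT.
Qed.

(** Mirror image of the previous argument, by induction on [n - k]: letters become fixed from the
    last one downwards. *)
Lemma agree_above c v k : (forall j, k <= j -> r j (to c v) = r j c) ->
  exists2 w : {perm 'I_n}, (forall x : 'I_n, k <= x -> w x = x) & to c w = to c v.
Proof.
have [m] := ubnP (n - k); elim: m k => // m IHm k ltm Hr.
have [nk|ltk] := leqP n k.
  by exists v => // x kx; have := leq_trans (ltn_ord x) (leq_trans nk kx); rewrite ltnn.
have [||w wk cw] := IHm k.+1; [lia | by move=> j kj; apply: Hr; apply: ltnW |].
pose o := Ordinal ltk; pose b := w^-1 o; have wb : w b = o by rewrite permKV.
have wgt x : (k < w x) = (k < x).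
  apply/idP/idP => [wx|xk]; last by rewrite wk.
  by rewrite -(perm_inj (wk _ wx)).
have bk : b <= k by rewrite leqNgt -wgt wb ltnn.
have fixb : to c (tperm b o) = c.
  have [<-|ob] := eqVneq o b; first by rewrite tperm1 act1.
  have kneb : k != b by [].
  apply: (@tperm_fix k); first by rewrite /= leqnn andbT; lia.
  rewrite -[RHS]Hr // -cw; apply: rank_eq => x.
  rewrite [RHS]ltnNge [X in ~~ X]leq_eqVlt wgt negb_or.
  have -> : (k == val (w x)) = (x == b).
    by rewrite eq_sym -(inj_eq (@perm_inj _ w)) wb.
  case: tpermP => [->|->|/eqP xb /eqP xo] /=; rewrite ?eqxx ?ltnn //=.
    by rewrite (negPf ob) /=; lia.
  rewrite (negPf xb) /=; move: xo; rewrite -val_eqE /=; lia.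
exists (tperm b o * w) => [x|]; last by rewrite actM fixb.
rewrite leq_eqVlt permM => /orP[/eqP xk|xk].
  by rewrite (_ : x = o) ?tpermR //; apply: val_inj.
by rewrite tpermD ?wk // -val_eqE /= neq_ltn ?xk ?orbT // (leq_ltn_trans bk xk).
Qed.

(** * Splicing chains through a common element *)

Hypothesis mix : forall c c' k, k <= n -> r k c = r k c' ->
  exists c'', (forall j, j <= k -> r j c'' = r j c) /\
              (forall j, k <= j -> r j c'' = r j c').

(** The spliced chain is reached from c.g by some [v] fixing the letters below k, and leads to c.h
    by some [w] fixing the others. Hence [g * v * w * h^-1] stabilizes [c], while [v] and [w]
    preserve the first k letters. *)
Lemma rank_inj c k (g h : {perm 'I_n}) : orbit to [set: {perm 'I_n}] c =i predT ->
  k <= n -> r k (to c g) = r k (to c h) ->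
  exists2 s, to c s = c & forall x, (h (s x) < k) = (g x < k).
Proof.
move=> trans kn /(mix kn)[c3 [below above]].
have conn c' : exists a, to c a = c'.
  by have /orbitP[a _ <-] : c' \in orbit to setT c; [rewrite trans | exists a].
have [a ca] := conn c3.
have [||v vk cv] := @agree_below (to c g) (g^-1 * a) k.
- by [].
- by move=> j jk; rewrite -actM mulKVg ca below.
rewrite -[RHS]actM mulKVg ca in cv.
have [|w wk cw] := @agree_above c3 (a^-1 * h) k.
  by move=> j jk; rewrite -[in LHS]ca -actM mulKVg above.
rewrite -[in RHS]ca -[RHS]actM mulKVg in cw.
exists (g * v * w * h^-1); first by rewrite !actM cv cw -actM mulgV act1.
move=> x; rewrite !permM permKV.
transitivity (v (g x) < k).
  apply/idP/idP; first by apply: contraTT; rewrite -!leqNgt => kv; rewrite wk.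
  apply: contraTT; rewrite -!leqNgt => kw.
  by rewrite -{1}(perm_inj (wk _ kw)).
apply/idP/idP => [kv|kg]; last by rewrite vk.
by rewrite -{1}(perm_inj (vk _ kv)).
Qed.

End AbstractLocalAction.

(** * Maximal chains of a ranked poset *)

Section MaximalChains.
Variables (d : Order.disp_t) (P : finPOrderType d) (n : nat) (bot top : P).
Variable rk : P -> nat.
Hypothesis rankedP : ranked_of_rank n bot top rk.
Implicit Types (x y z : P) (C : {set P}) (c : maxchains P).

Lemma is_chainP C :
  reflect {in C &, forall x y, (x <= y)%O || (y <= x)%O} (is_chain C).
Proof.
apply: (iffP forallP) => [H x y xC yC|H x].
  by move: (H x) => /implyP/(_ xC)/forallP/(_ y)/implyP/(_ yC).
by apply/implyP => xC; apply/forallP => y; apply/implyP => yC; apply: H.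
Qed.

Lemma maxchain_total c : {in val c &, forall x y, (x <= y)%O || (y <= x)%O}.
Proof. by apply/is_chainP; case: c => C /= /andP[]. Qed.

Lemma mem_maxchain c x : {in val c, forall y, (x <= y)%O || (y <= x)%O} -> x \in val c.
Proof.
move=> cx; case/andP: (valP c) => _ /forallP/(_ (x |: val c)).
rewrite subsetUr andbT; case: is_chainP => [_ /eqP <-|[]]; first exact: setU11.
move=> y z /setU1P[->|yc] /setU1P[->|zc]; rewrite ?lexx //.
- exact: (cx z zc).
- by rewrite orbC (cx y yc).
- exact: (maxchain_total yc zc).
Qed.

Lemma extend_maxchain C : is_chain C -> exists c, C \subset val c.
Proof.
case/(@maxset_exists P) => D /maxsetP[chD maxD] sCD.
have mD : is_maxchain D.
  rewrite /is_maxchain chD; apply/forallP => E; apply/implyP => /andP[chE sDE].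
  by rewrite (maxD E).
by exists (exist _ D mD).
Qed.

(** Induction on the size of the open interval; an empty interval is a cover, where the rank grows
    by one. *)
Lemma rk_lt x y : (x < y)%O -> rk x < rk y.
Proof.
have [_ _ _ _ rkS] := rankedP.
have [m] := ubnP #|[set z | (x < z < y)%O]|; elim: m x y => // m IHm x y ltm xy.
have [z /andP[xz zy]|nz] := pickP (fun z => (x < z < y)%O); last first.
  by rewrite (rkS x y) // /covers xy; apply/forallP => z; rewrite nz.
rewrite ltnS in ltm.
apply: (@ltn_trans (rk z)); apply: IHm => //; apply: leq_trans ltm;
  apply: proper_card; apply/properP.
- split; last by exists z; rewrite !inE ?xz ?ltxx ?andbF.
  by apply/subsetP => t; rewrite !inE => /andP[-> /lt_trans->].
- split; last by exists z; rewrite !inE ?xz ?ltxx ?andbF.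
  by apply/subsetP => t; rewrite !inE => /andP[/(lt_trans xz)-> ->].
Qed.

Lemma rk_le x y : (x <= y)%O -> rk x <= rk y.
Proof. by rewrite le_eqVlt => /orP[/eqP->//|/rk_lt/ltnW]. Qed.

Lemma rk_inj_chain c : {in val c &, injective rk}.
Proof.
move=> x y xc yc rxy; have := maxchain_total xc yc; rewrite !le_eqVlt eq_sym.
have [//|_ /=] := eqVneq y x.
by case/orP=> /rk_lt; rewrite rxy ltnn.
Qed.

Lemma rk_chain_le c x y : x \in val c -> y \in val c -> rk x <= rk y -> (x <= y)%O.
Proof.
move=> xc yc rxy; have := maxchain_total xc yc; case/orP=> //.
by rewrite le_eqVlt => /orP[/eqP->//|/rk_lt]; rewrite ltnNge rxy.
Qed.

Lemma maxchain_rank c k : k <= n -> exists2 x, x \in val c & rk x = k.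
Proof.
have [minbot maxtop rk0 rkn rkS] := rankedP.
elim: k => [_|k IHk ltk].
  by exists bot; rewrite ?mem_maxchain // => y _; rewrite minbot.
have [x xc rx] := IHk (ltnW ltk).
have topc : top \in val c by rewrite mem_maxchain // => y _; rewrite maxtop orbT.
have xtop : (x < top)%O.
  by rewrite lt_neqAle maxtop andbT; apply: contraTneq ltk => xt; rewrite -rx xt rkn ltnn.
(* The chain element of least rank above [x] covers [x]: anything in between is comparable to the
   whole chain, hence in it, against minimality. *)
pose Q y := (y \in val c) && (x < y)%O.
have Qtop : Q top by rewrite /Q topc.
case: (@arg_minnP _ top Q rk Qtop) => y /andP[yc xy] miny.
exists y => //; rewrite -rx; apply: rkS; rewrite /covers xy; apply/forallP => z.
apply/negP => /andP[xz zy].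
have /(conj xz)/andP : z \in val c.
  apply: mem_maxchain => t tc; have [tx|] := boolP (t <= x)%O.
    by rewrite (le_trans tx) ?orbT // ltW.
  move=> ntx; have xt : (x < t)%O.
    rewrite lt_neqAle; case/orP: (maxchain_total tc xc) => [tx|->].
      by rewrite tx in ntx.
    by rewrite andbT; apply: contraNneq ntx => ->.
  have := miny t; rewrite /Q tc xt => /(_ isT) /(rk_chain_le yc tc) yt.
  by rewrite (le_trans (ltW zy) yt).
by rewrite andbC => /miny; rewrite leqNgt rk_lt.
Qed.

(** The default [bot] is the value at every rank beyond [n], which makes the abstract hypotheses
    hold for all k. *)
Definition rank_elt k c : P := odflt bot [pick x in val c | rk x == k].

Lemma rank_elt_rk c x : x \in val c -> rank_elt (rk x) c = x.
Proof.
rewrite /rank_elt => xc; case: pickP => [y /andP[yc /eqP rxy]|/(_ x)].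
  exact: (rk_inj_chain yc xc).
by rewrite xc eqxx.
Qed.

Lemma rank_eltP c k : k <= n -> rank_elt k c \in val c /\ rk (rank_elt k c) = k.
Proof. by case/(maxchain_rank c) => x xc <-; rewrite rank_elt_rk. Qed.

Lemma rk_max x : rk x <= n.
Proof. by have [_ maxtop _ <- _] := rankedP; apply: rk_le. Qed.

Lemma rank_elt_gt c k : n < k -> rank_elt k c = bot.
Proof.
rewrite /rank_elt => nk; case: pickP => //= x /andP[_ /eqP rx].
by have := rk_max x; rewrite rx leqNgt nk.
Qed.

Lemma rank_elt_ext c c' : (forall k, rank_elt k c = rank_elt k c') -> c = c'.
Proof.
move=> H; have sub c1 c2 : (forall k, rank_elt k c1 = rank_elt k c2) -> {subset val c1 <= val c2}.
  move=> {}H x xc; rewrite -(rank_elt_rk xc) H.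
  by case: (rank_eltP c2 (rk_max x)).
by apply/val_inj/setP => x; apply/idP/idP; apply: sub.
Qed.

Lemma rank_elt_local (to : {action {perm 'I_n} &-> maxchains P}) :
  local_action rk to -> forall i j : 'I_n, val j = (val i).+1 ->
  forall c k, k != val j -> rank_elt k (to c (tperm i j)) = rank_elt k c.
Proof.
move=> loc i j ij c k kj; have [kn|nk] := leqP k n; last by rewrite !rank_elt_gt.
have [xc rx] := rank_eltP c kn.
have: rank_elt k c \in [set x in val c | rk x != val j] by rewrite inE xc rx.
by rewrite -(loc i j ij c) inE => /andP[/rank_elt_rk]; rewrite rx.
Qed.

(** The part of [c] below the common element and the part of [c'] above it form a chain, which
    extends to a maximal one. *)
Lemma rank_elt_mix c c' k : k <= n -> rank_elt k c = rank_elt k c' ->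
  exists c'', (forall j, j <= k -> rank_elt j c'' = rank_elt j c) /\
              (forall j, k <= j -> rank_elt j c'' = rank_elt j c').
Proof.
move=> kn ecc'; pose z := rank_elt k c.
have [zc rz] := rank_eltP c kn; have [zc' _] := rank_eltP c' kn; rewrite -/z in zc rz.
rewrite -ecc' -/z in zc'.
pose C := [set x in val c | x <= z]%O :|: [set x in val c' | z <= x]%O.
have [|c'' sC] := @extend_maxchain C.
  apply/is_chainP => x y; rewrite !inE.
  case/orP=> /andP[xc xz] /orP[]/andP[yc yz].
  - exact: (maxchain_total xc yc).
  - by rewrite (le_trans xz yz).
  - by rewrite (le_trans yz xz) orbT.
  - exact: (maxchain_total xc yc).
exists c''; split=> j jk.
  have [xc rx] := rank_eltP c (leq_trans jk kn).
  rewrite -{1}rx rank_elt_rk // (subsetP sC) // !inE xc.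
  by rewrite (rk_chain_le xc zc) // rx rz.
have [jn|nj] := leqP j n; last by rewrite !rank_elt_gt.
have [xc rx] := rank_eltP c' jn.
rewrite -{1}rx rank_elt_rk // (subsetP sC) // !inE xc.
by rewrite (rk_chain_le zc' xc) ?orbT // rx rz.
Qed.

(** Comparable elements lie on a common maximal chain, so one permutation can describe both. *)
Lemma rank_elt_cover x y : (x <= y)%O ->
  exists c, rank_elt (rk x) c = x /\ rank_elt (rk y) c = y.
Proof.
move=> xy; have [|c sC] := @extend_maxchain [set x; y].
  by apply/is_chainP => u v /set2P[]-> /set2P[]->; rewrite ?lexx ?xy ?orbT.
by exists c; rewrite !rank_elt_rk // (subsetP sC) // !inE eqxx ?orbT.
Qed.

Lemma rank_elt_le c j k : j <= k <= n -> (rank_elt j c <= rank_elt k c)%O.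
Proof.
case/andP=> jk kn; have [xc rx] := rank_eltP c (leq_trans jk kn).
by have [yc ry] := rank_eltP c kn; rewrite (rk_chain_le xc yc) // rx ry.
Qed.

End MaximalChains.

(** * Power sums over Young subgroups *)

Section ColoringSums.
Local Open Scope ring_scope.
Variables (n : nat).
Implicit Types (w : {perm 'I_n}) (phi : {ffun 'I_n -> 'I_n}).

(** A degree bound independent of k puts the monomials of all fibers into one finite type, so that a
    product of such sums expands over finite functions. *)
Lemma hcomplete_widen k : (k <= n)%N ->
  hcomplete n k = \sum_(m : 'X_{1..n < n.+1} | mdeg (val m) == k) 'X_[val m].
Proof.
move=> kn; apply/mpolyP => m; rewrite !raddf_sum /=.
have coefX N : (k < N)%N ->
  \sum_(i : 'X_{1..n < N} | mdeg (val i) == k) ('X_[val i] : {mpoly rat[n]})@_m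
  = (mdeg m == k)%:R.
  move=> kN; have [mk|mk] := eqVneq (mdeg m) k; last first.
    rewrite big1 // => i /eqP ik; rewrite mcoeffX; case: eqP => // im.
    by move: mk; rewrite -im ik eqxx.
  have ltm : (mdeg m < N)%N by rewrite mk.
  rewrite (bigD1 (BMultinom ltm)) /=; last by rewrite mk.
  rewrite mcoeffX eqxx big1 ?addr0 // => i /andP[_ im]; rewrite mcoeffX.
  by case: eqP => // imm; case/eqP: im; apply: val_inj.
by rewrite !coefX.
Qed.

Lemma power_sum_cycleE w :
  power_sum_cycle w =
  \sum_(phi : {ffun 'I_n -> 'I_n} | [forall x, phi (w x) == phi x])
    \prod_x ('X_(phi x) : {mpoly rat[n]}).
Proof.
rewrite /power_sum_cycle big_sub bigA_distr_bigA.
have cycP x : porbit w x \in porbits w by apply: imset_f.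
pose cyc x : {C : {set 'I_n} | C \in porbits w} := Sub (porbit w x) (cycP x).
have reprP (C : {C : {set 'I_n} | C \in porbits w}) : {x | cyc x = C}.
  case: C => C CP; have /imsetP/sig2_eqW[x _ Cx] := CP.
  by exists x; apply: val_inj.
pose rep C := sval (reprP C); have repK C : cyc (rep C) = C by exact: (svalP (reprP C)).
have cyc_w x : cyc (w x) = cyc x.
  by apply: val_inj; apply/eqP; rewrite /= eq_porbit_mem (mem_porbit w 1 x).
(* Colorings of the cycles correspond to colorings of the letters constant on cycles, through [cyc]
   and its section [rep]. *)
rewrite (reindex_onto
  (fun f : {ffun {C : {set 'I_n} | C \in porbits w} -> 'I_n} =>
     [ffun x => f (cyc x)] : {ffun 'I_n -> 'I_n})
  (fun phi : {ffun 'I_n -> 'I_n} => [ffun C => phi (rep C)])) /=; last first.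
  move=> phi /forallP phiw; apply/ffunP => x; rewrite !ffunE.
  have: x \in porbit w (rep (cyc x)) by rewrite -[porbit _ _]/(val (cyc _)) repK porbit_id.
  set y := rep _; case/porbitP => i ->; elim: i => [|i IHi]; first by rewrite expg0 perm1.
  by rewrite expgSr permM (eqP (phiw _)).
apply: eq_big => [f|f _].
  apply/esym/andP; split; first by apply/forallP => x; rewrite !ffunE cyc_w.
  by apply/eqP/ffunP => C; rewrite !ffunE repK.
rewrite [RHS](partition_big cyc predT) //=; apply: eq_bigr => C _.
rewrite (eq_bigr (fun=> 'X_(f C))) => [|x /eqP <-]; last by rewrite ffunE.
rewrite prodr_const; congr (_ ^+ _); apply: eq_card => x.
transitivity (cyc x == C) => //; rewrite -[in LHS](repK C) -[in RHS](repK C).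
by rewrite -[LHS]eq_porbit_mem.
Qed.

Variables (K : finType) (kappa : 'I_n -> K).

(** The Young subgroup of the fibers of [kappa], in pointwise form. *)
Definition fiber_perms : {set {perm 'I_n}} :=
  [set g : {perm 'I_n} | [forall x, kappa (g x) == kappa x]].

Lemma fiber_permsP (g : {perm 'I_n}) :
  reflect (forall x, kappa (g x) = kappa x) (g \in fiber_perms).
Proof. by rewrite inE; apply: (iffP forallP) => H x; apply/eqP. Qed.

Definition fiber_size k := #|[set x | kappa x == k]|.

Lemma fiber_size_le k : (fiber_size k <= n)%N.
Proof. by rewrite -[leqRHS]card_ord max_card. Qed.

Definition content_mnm phi k : 'X_{1..n} :=
  [multinom #|[set x | (kappa x == k) && (phi x == v)]| | v < n].

Lemma mdeg_content phi k : mdeg (content_mnm phi k) = fiber_size k.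
Proof.
rewrite mdegE /fiber_size -sum1_card [RHS](partition_big phi predT) //=.
apply: eq_bigr => v _; rewrite mnmE -sum1_card; apply: eq_bigl => x.
by rewrite !inE.
Qed.

Lemma content_bound phi k : (mdeg (content_mnm phi k) < n.+1)%N.
Proof. by rewrite mdeg_content ltnS fiber_size_le. Qed.

(** A complete invariant for the orbits of [fiber_perms] on colorings: how often each color occurs
    in each fiber. *)
Definition content phi : {ffun K -> 'X_{1..n < n.+1}} :=
  [ffun k => BMultinom (content_bound phi k)].

Lemma contentE phi k v :
  val (content phi k) v = #|[set x | (kappa x == k) && (phi x == v)]|.
Proof. by rewrite ffunE mnmE. Qed.

Lemma coloring_monomial phi :
  \prod_x ('X_(phi x) : {mpoly rat[n]}) = \prod_k 'X_[val (content phi k)].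
Proof.
rewrite (partition_big kappa predT) //=; apply: eq_bigr => k _.
rewrite mpolyXE_id (partition_big phi predT) //=; apply: eq_bigr => v _.
rewrite contentE (eq_bigr (fun=> 'X_v)) => [|x /andP[_ /eqP->] //].
by rewrite prodr_const; congr (_ ^+ _); apply: eq_card => x; rewrite [RHS]inE.
Qed.

(** Equal contents mean equal multisets of pairs (fiber, color), and a permutation matching the two
    lists of pairs preserves fibers. *)
Lemma content_perm phi psi : content phi = content psi ->
  exists2 h, h \in fiber_perms & phi = [ffun x => psi (h x)].
Proof.
move=> eqc; pose s (phi : {ffun 'I_n -> 'I_n}) := [tuple (kappa x, phi x) | x < n].
have cnt phi' k v : count_mem (k, v) (s phi') = val (content phi' k) v.
  rewrite contentE /= count_map cardE -size_filter; congr size.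
  rewrite {2}/enum_mem -enumT; apply: eq_filter => x /=.
  by rewrite inE xpair_eqE.
have: perm_eq (s phi) (s psi).
  by apply/allP => -[k v] _ /=; rewrite -/(s phi) -/(s psi) !cnt eqc.
case/tuple_permP => h /val_inj shE.
have {}shE x : (kappa x, phi x) = (kappa (h x), psi (h x)).
  by have := congr1 (fun t => tnth t x) shE; rewrite !tnth_mktuple.
exists h; last by apply/ffunP => x; rewrite ffunE; case: (shE x).
by apply/fiber_permsP => x; case: (shE x).
Qed.

Lemma content_comp phi h : h \in fiber_perms ->
  content [ffun x => phi (h x)] = content phi.
Proof.
move=> /fiber_permsP hP; apply/ffunP => k; apply/val_inj/mnmP => v.
rewrite !contentE -[RHS](card_preimset _ (@perm_inj _ h)).
by apply: eq_card => x; rewrite !inE ffunE hP.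
Qed.

Lemma content_surj (m : K -> 'X_{1..n < n.+1}) :
  (forall k, mdeg (val (m k)) = fiber_size k) ->
  exists phi, forall k, content phi k = m k.
Proof.
move=> mdegm.
(* Each fiber is colored, in the order of its enumeration, by the word that repeats every color as
   often as [m] prescribes. *)
pose L k := flatten [seq nseq (val (m k) v) v | v <- enum 'I_n].
pose E k := enum [set x | kappa x == k].
have sizeL k : size (L k) = size (E k).
  rewrite -cardE -/(fiber_size k) -mdegm mdegE size_flatten /shape -map_comp.
  rewrite sumnE big_map big_enum; apply: eq_bigr => v _.
  by rewrite /= size_nseq.
exists [ffun x => nth x (L (kappa x)) (index x (E (kappa x)))] => k.
apply/val_inj/mnmP => v; rewrite contentE.
set phi := finfun _.
have phiL : map phi (E k) = L k.
  have [E0|[x0 _]] : E k = [::] \/ exists x0, x0 \in E k.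
    by case: (E k) => [|x0 t]; [left | right; exists x0; rewrite mem_head].
    by have := sizeL k; rewrite E0 => /size0nil ->.
  apply: (@eq_from_nth _ x0) => [|i]; rewrite size_map ?sizeL // => ltiE.
  rewrite (nth_map x0) // ffunE; set x := nth x0 _ i.
  have: x \in E k by apply: mem_nth.
  rewrite mem_enum inE => /eqP ->; rewrite index_uniq ?enum_uniq //.
  by apply: set_nth_default; rewrite sizeL.
transitivity (count_mem v (L k)).
  rewrite -phiL count_map cardE -size_filter; congr size.
  rewrite /E /enum_mem -filter_predI; apply: eq_filter => x.
  by rewrite /= !inE andbC.
rewrite count_flatten -map_comp sumnE big_map big_enum (bigD1 v) //=.
rewrite count_nseq /= eqxx mul1n big1 ?addn0 // => u uv.
by rewrite count_nseq /= (negPf uv).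
Qed.

(** Stabilizer orders over one orbit add up to the group order: the elements carrying [phi0] to
    [phi] form a coset of the stabilizer of [phi]. *)
Lemma sum_coloring_stab (m : {ffun K -> 'X_{1..n < n.+1}}) :
  (forall k, mdeg (val (m k)) = fiber_size k) ->
  (\sum_(phi | content phi == m)
    #|[set w in fiber_perms | [forall x, phi (w x) == phi x]]| = #|fiber_perms|)%N.
Proof.
case/content_surj => phi0 /ffunP <-.
rewrite -[RHS]sum1_card (partition_big
  (fun h : {perm 'I_n} => [ffun x => phi0 (h x)])
  (fun phi => content phi == content phi0)) /=;
  last by move=> h /content_comp ->.
apply: eq_bigr => phi /eqP /content_perm[h0 h0P phiE]; rewrite sum1_card.
rewrite -(card_imset _ (mulIg h0)); apply: eq_card => h.
apply/imsetP/andP => [[w]|[hP /eqP/ffunP hE]].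
  rewrite inE => /andP[/fiber_permsP wP /forallP wE] ->; split.
    by apply/fiber_permsP => x; rewrite permM (fiber_permsP _ h0P) wP.
  by apply/eqP/ffunP => x; rewrite ffunE permM; have /eqP := wE x; rewrite phiE !ffunE.
exists (h * h0^-1)%g; last by rewrite mulgKV.
have h0V x : kappa (h0^-1%g x) = kappa x by rewrite -[in RHS](permKV h0 x) (fiber_permsP _ h0P).
rewrite inE; apply/andP; split.
  by apply/fiber_permsP => x; rewrite permM h0V (fiber_permsP _ hP).
apply/forallP => x; rewrite phiE !ffunE permM permKV.
by have := hE x; rewrite phiE !ffunE => ->.
Qed.

(* The sum runs over pairs (w, phi) with phi a coloring fixed by w; the
   fiber-preserving permutations act on colorings with orbits indexed by the
   families of monomials occurring in the product of the h_k. *)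
Lemma sum_power_sum_cycle :
  \sum_(w in fiber_perms) power_sum_cycle w =
  #|fiber_perms|%:R *: \prod_k hcomplete n (fiber_size k).
Proof.
rewrite (eq_bigr _ (fun w _ => power_sum_cycleE w)).
rewrite (exchange_big_dep predT) //=.
rewrite (eq_bigr (fun phi => (\prod_k 'X_[val (content phi k)]) *+
   #|[set w in fiber_perms | [forall x, phi (w x) == phi x]]|)); last first.
  move=> phi _; rewrite sumr_const coloring_monomial; congr (_ *+ _).
  by apply: eq_card => w; rewrite [RHS]inE.
rewrite [in RHS](eq_bigr _ (fun k _ => hcomplete_widen (fiber_size_le k))).
rewrite bigA_distr_big_dep scaler_sumr.
rewrite (partition_big content (fun m => m \in family
  (fun k (m : 'X_{1..n < n.+1}) => mdeg (val m) == fiber_size k))) /=; last first.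
  by move=> phi _; apply/familyP => k; rewrite ffunE unfold_in /= mdeg_content.
apply: eq_bigr => m /familyP mP.
rewrite (eq_bigr (fun phi : {ffun 'I_n -> 'I_n} => (\prod_k 'X_[val (m k)]) *+
   #|[set w in fiber_perms | [forall x, phi (w x) == phi x]]|)); last first.
  by move=> phi /eqP ->.
rewrite sumrMnr sum_coloring_stab ?scaler_nat // => k.
by apply/eqP; apply: mP.
Qed.

End ColoringSums.

(** * Specializations of complete homogeneous symmetric functions *)

Section Specializations.
Local Open Scope ring_scope.

(** At (1, 0, 0, ...) only the k-th power of the first variable survives; the hypothesis provides
    this variable when k is positive. *)
Lemma hcomplete_eval_one n k : (k == 0)%N || (0 < n)%N ->
  (hcomplete n k).@[fun i : 'I_n => ((i : nat) == 0)%:R] = 1.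
Proof.
move=> kn; rewrite /hcomplete raddf_sum /=.
pose m0 : 'X_{1..n} := [multinom (if (i : nat) == 0 then k else 0)%N | i < n].
have degm0 : mdeg m0 = k.
  rewrite mdegE (eq_bigr (fun i : 'I_n => if (i : nat) == 0 then k else 0)%N) => [|i _].
    case: (n) kn => [|n'] /=; first by rewrite orbF big_ord0 => /eqP.
    by rewrite big_ord_recl big1 ?addn0.
  by rewrite mnmE.
have ltm0 : (mdeg m0 < k.+1)%N by rewrite degm0.
rewrite (bigD1 (BMultinom ltm0)) /=; last by rewrite degm0.
rewrite mevalX big1 => [|i _]; last first.
  by rewrite mnmE; case: eqP => _; rewrite ?expr1n ?expr0.
rewrite big1 ?addr0 // => m /andP[/eqP degm mm0].
have [i /andP[i0 mi]] : exists i : 'I_n, ((i : nat) != 0)%N && (val m i != 0)%N.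
  apply/existsP; apply: contraNT mm0; rewrite negb_exists => /forallP H.
  have H' (i : 'I_n) : (i : nat) != 0%N -> val m i = 0%N.
    by move=> ni0; have := H i; rewrite ni0 /= negbK => /eqP.
  apply/eqP/val_inj/mnmP => i; rewrite mnmE; case: eqP => [i0|/eqP/H' //].
  rewrite -[RHS]degm mdegE (bigD1 i) //= big1 ?addn0 // => j ji; apply: H'.
  by apply: contraNneq ji => j0; apply/eqP/val_inj; rewrite /= j0 i0.
by rewrite mevalX (bigD1 i) //= (negPf i0) expr0n (negPf mi) mul0r.
Qed.

(** At (1, q, 0, ...) the surviving monomials are determined by the exponent j of the second
    variable. The target ring is general so that [q] may be an indeterminate. *)
Lemma hcomplete_mmap_two n k (S : comNzRingType) (f : {rmorphism rat -> S})
    (i0 i1 : 'I_n) (q : S) : i0 != i1 ->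
  mmap f (fun i => if i == i0 then 1 else if i == i1 then q else 0) (hcomplete n k)
  = \sum_(j < k.+1) q ^+ j.
Proof.
move=> i01; set v := fun i => _; have i10 : i1 != i0 by rewrite eq_sym.
rewrite /hcomplete raddf_sum /=; under eq_bigr do rewrite mmapX /mmap1.
have vE (m : 'X_{1..n}) : \prod_i v i ^+ m i =
    q ^+ m i1 * (\sum_(i | (i != i0) && (i != i1)) m i == 0)%N%:R.
  rewrite (bigD1 i0) //= (bigD1 i1) //= /v !eqxx expr1n mul1r (negPf i10).
  congr (_ * _); have [s0|] := eqVneq.
    rewrite big1 // => i /andP[j0 j1]; rewrite (negPf j0) (negPf j1).
    suff -> : m i = 0%N by [].
    by apply/eqP; rewrite -leqn0 -s0 (bigD1 i) ?j0 //= leq_addr.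
  rewrite -lt0n => s0; have [i /andP[/andP[j0 j1] mi]|H] := pickP
    (fun i => (i != i0) && (i != i1) && (m i != 0%N)).
    by rewrite (bigD1 i) ?j0 //= (negPf j0) (negPf j1) expr0n (negPf mi) mul0r.
  move: s0; rewrite big1 // => i ji; apply/eqP.
  by move: (H i); rewrite ji /= => /negbFE.
under eq_bigr do rewrite vE.
have degE (m : 'X_{1..n}) :
    mdeg m = (m i0 + (m i1 + \sum_(i | (i != i0) && (i != i1)) m i))%N.
  by rewrite mdegE (bigD1 i0) //= (bigD1 i1).
rewrite (bigID (fun m : 'X_{1..n < k.+1} =>
  (\sum_(i | (i != i0) && (i != i1)) val m i == 0)%N)) /= addrC big1 ?add0r; last first.
  by move=> m /andP[_ /negPf->]; rewrite mulr0.
pose mu (j : 'I_k.+1) : 'X_{1..n} :=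
  [multinom (if i == i0 then k - j else if i == i1 then j : nat else 0)%N | i < n].
have mu0 j : (\sum_(i | (i != i0) && (i != i1)) mu j i = 0)%N.
  by rewrite big1 // => i /andP[j0 j1]; rewrite mnmE (negPf j0) (negPf j1).
have mdeg_mu j : mdeg (mu j) = k.
  by rewrite degE mu0 !mnmE !eqxx (negPf i10) addn0 subnK // -ltnS.
have ltmu j : (mdeg (mu j) < k.+1)%N by rewrite mdeg_mu.
rewrite (reindex_onto (fun j => BMultinom (ltmu j))
   (fun m : 'X_{1..n < k.+1} => inord (val m i1))) /=; last first.
  move=> m /andP[/eqP degm /eqP s0].
  have ltk : (val m i1 < k.+1)%N by rewrite ltnS -[leqRHS]degm degE addnCA leq_addr.
  apply/val_inj/mnmP => i; rewrite mnmE inordK //.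
  case: eqP => [->|/eqP j0]; first by rewrite -[X in (X - _)%N]degm degE s0 addn0 addnK.
  case: eqP => [->//|/eqP j1]; apply/esym/eqP.
  by rewrite -leqn0 -s0 (bigD1 i) ?j0 //= leq_addr.
apply: eq_big => [j|j _]; last by rewrite mu0 eqxx mulr1 mnmE eqxx (negPf i10).
by rewrite mdeg_mu mu0 !eqxx mnmE eqxx (negPf i10) inord_val eqxx.
Qed.

(** The q-integer of k+1, that is (q^(k+1) - 1)/(q - 1). *)
Let qint k : {poly algC} := \sum_(j < k.+1) 'X^j.

Lemma qint_eval k z : (qint k).[z] * (z - 1) = z ^+ k.+1 - 1.
Proof.
rewrite subrX1 mulrC horner_sum; congr (_ * _).
by apply: eq_bigr => j _; rewrite hornerXn.
Qed.

(* Evaluate at a primitive (a+1)-st root of unity, a being the largest index. *)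
Lemma mem_qint_prod s t a : \prod_(k <- s) qint k = \prod_(k <- t) qint k ->
  all (fun k => 0 < k <= a)%N t -> a \in s -> (0 < a)%N -> a \in t.
Proof.
move=> eqst /allP ta sa a0; have [z prz] := C_prim_root_exists (ltn0Sn a).
have z1 : z - 1 != 0.
  by rewrite subr_eq0 -[z]expr1 -(prim_order_dvd prz) dvdn1 eqSS -lt0n.
have: (\prod_(k <- t) qint k).[z] == 0.
  rewrite -eqst horner_prod (big_rem a) //= mulf_eq0.
  have -> : (qint a).[z] = 0; last by rewrite eqxx.
  by apply: (mulIf z1); rewrite qint_eval mul0r prim_expr_order // subrr.
(* A factor of index [b] vanishing at [z] forces a+1 to divide b+1, while [b] is at most [a]. *)
rewrite horner_prod prodf_seq_eq0 => /hasP[b bt /= /eqP qb].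
have := qint_eval b z; rewrite qb mul0r => /esym/eqP; rewrite subr_eq0.
rewrite -(prim_order_dvd prz) => /(dvdn_leq (ltn0Sn b)); rewrite ltnS => ab.
by have /andP[_ ba] := ta _ bt; rewrite (_ : a = b) //; apply/eqP; rewrite eqn_leq ab.
Qed.

Lemma qint_neq0 k : qint k != 0.
Proof.
apply: contraNneq (oner_neq0 algC) => q0; have := congr1 (coefp 0) q0; rewrite /coefp /=.
by rewrite coef0 coef_sum big_ord_recl coefXn big1 ?addr0 => [/eqP|i _] //; rewrite coefXn.
Qed.

(** The largest index of either list occurs in both; its factor is cancelled and induction
    applies. *)
Lemma qint_prod_inj s t : all (fun k => 0 < k)%N s -> all (fun k => 0 < k)%N t ->
  \prod_(k <- s) qint k = \prod_(k <- t) qint k -> perm_eq s t.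
Proof.
have [m] := ubnP (size s); elim: m s t => // m IHm s t ltm s0 t0 eqst.
have [u0|[x xu]] : s ++ t = [::] \/ exists x, x \in s ++ t.
- by case: (s ++ t) => [|x u]; [left | right; exists x; rewrite mem_head].
- by move: u0; case: (s) => //; case: (t).
have bound b : b \in s ++ t -> (b <= \max_(k <- s ++ t) k)%N.
  by move=> bu; apply: leq_bigmax_seq.
have [a au maxa] := ex_maxnP (ex_intro (fun b => b \in s ++ t) x xu) bound.
have small u : {subset u <= s ++ t} -> all (fun k => 0 < k)%N u ->
    all (fun k => 0 < k <= a)%N u.
  by move=> su /allP u0; apply/allP => k ku; rewrite u0 // maxa // su.
have a0 : (0 < a)%N by move: au; rewrite mem_cat => /orP[/(allP s0)|/(allP t0)].
have sma : all (fun k => 0 < k <= a)%N s by apply: small => // k ks; rewrite mem_cat ks.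
have tma : all (fun k => 0 < k <= a)%N t by apply: small => // k kt; rewrite mem_cat kt orbT.
have [sa ta] : a \in s /\ a \in t.
  move: au; rewrite mem_cat => /orP[sa|ta]; split=> //.
    exact: (mem_qint_prod eqst).
  exact: (mem_qint_prod (esym eqst)).
rewrite (perm_trans (perm_to_rem sa)) // perm_sym (perm_trans (perm_to_rem ta)) //.
rewrite perm_cons perm_sym; apply: IHm.
- by rewrite size_rem // -ltnS prednK //; case: (s) sa.
- by apply/allP => k /mem_rem /(allP s0).
- by apply/allP => k /mem_rem /(allP t0).
apply: (mulfI (qint_neq0 a)); move: eqst.
by rewrite (big_rem a sa) (big_rem a ta).
Qed.

End Specializations.

(** * Young subgroups of set partitions *)

Section YoungSubgroups.
Variables (n : nat) (B : {set {set 'I_n}}).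
Hypothesis partB : partition B [set: 'I_n].

Lemma mem_pblockT x : x \in pblock B x.
Proof. by rewrite mem_pblock (cover_partition partB) inE. Qed.

Lemma pblock_memT x : pblock B x \in B.
Proof. by rewrite pblock_mem // (cover_partition partB) inE. Qed.

Lemma pblock_eqE b x : b \in B -> (pblock B x == b) = (x \in b).
Proof.
move=> bB; have [_ triB _] := and3P partB.
by apply/eqP/idP => [<-|/(def_pblock triB bB)//]; apply: mem_pblockT.
Qed.

(** A permutation preserving every block is the product of its restrictions to the blocks. *)
Lemma young_subgroupE : young_subgroup B = fiber_perms (pblock B).
Proof.
apply/setP => g; apply/prodsgP/fiber_permsP => [[c cP ->]|gP].
  apply: (big_ind (fun g : {perm 'I_n} => forall x, pblock B (g x) = pblock B x)).
  - by move=> x; rewrite perm1.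
  - by move=> u v Hu Hv x; rewrite permM Hv Hu.
  move=> b bB x; have := cP b bB; rewrite inE => cb.
  have [xb|xb] := boolP (x \in b); last by rewrite (out_perm cb).
  by apply/eqP; rewrite (eqP (_ : pblock B x == b)) pblock_eqE // perm_closed.
have gN b : b \in B -> g \in 'N(b | 'P).
  by move=> bB; apply/astabsP => x; rewrite /= apermE -!(pblock_eqE _ bB) gP.
exists (fun b => restr_perm b g) => [b bB|]; first by rewrite inE restr_perm_on.
(* Restrictions to distinct blocks have disjoint supports, so at most one factor moves [x]. *)
have prodE r x : uniq r -> {subset r <= B} ->
    (\prod_(b <- r) restr_perm b g) x = if pblock B x \in r then g x else x.
  elim: r x => [|b r IHr] x; first by rewrite big_nil perm1.
  rewrite cons_uniq big_cons permM inE => /andP[br ur] sr.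
  have bB : b \in B by apply: sr; rewrite mem_head.
  have sr' : {subset r <= B} by move=> y yr; apply: sr; rewrite inE yr orbT.
  rewrite pblock_eqE //; have [xb|xb] := boolP (x \in b).
    rewrite restr_permE ?gN // IHr // gP; move: xb; rewrite -pblock_eqE // => /eqP ->.
    by rewrite (negPf br).
  by rewrite (out_perm (restr_perm_on b g)) // IHr.
apply/permP => x; rewrite -big_filter; case: big_enumP => e _ [Ue mem_e] _.
by rewrite prodE // => [|b]; rewrite mem_e ?pblock_memT.
Qed.

Definition block_sizes := sort geq [seq #|b| | b : {set 'I_n} <- enum B].

Lemma block_sizes_partition : is_partition n block_sizes.
Proof.
have [_ _ B0] := and3P partB.
rewrite /is_partition sort_sorted /=; last by move=> x y; apply: leq_total.
rewrite all_sort all_map; apply/andP; split.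
  apply/allP => b; rewrite mem_enum /= => bB; rewrite card_gt0.
  by apply: contraNneq B0 => <-.
rewrite sumnE (perm_big _ (permEl (perm_sort _ _))) big_map big_enum /=.
by rewrite -(card_partition partB) cardsT card_ord.
Qed.

Local Open Scope ring_scope.

Lemma hcomplete0 : hcomplete n 0 = 1.
Proof.
have lt0 : (mdeg (0%MM : 'X_{1..n}) < 1)%N by rewrite mdeg0.
rewrite /hcomplete (bigD1 (BMultinom lt0)) /= ?mdeg0 // mpolyX0 big1 ?addr0 //.
move=> m /andP[m0 mn0]; case/eqP: mn0; apply: val_inj.
by apply/eqP; rewrite /= -mdeg_eq0.
Qed.

(** On the right k runs over all sets of letters; one that is not a block has an empty fiber and
    contributes h_0 = 1. *)
Lemma hprod_block_sizes :
  hprod n block_sizes = \prod_k hcomplete n (fiber_size (pblock B) k).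
Proof.
rewrite /hprod (perm_big _ (permEl (perm_sort _ _))) big_map big_enum /=.
rewrite [RHS](bigID (mem B)) /= [X in _ = _ * X]big1 ?mulr1 => [|b bB].
  apply: eq_bigr => b bB; congr hcomplete; apply: eq_card => x.
  by rewrite inE pblock_eqE.
rewrite /fiber_size (_ : [set x | _] = set0) ?cards0 ?hcomplete0 //.
apply/setP => x; rewrite !inE; apply: contraNF bB => /eqP <-.
exact: pblock_memT.
Qed.

End YoungSubgroups.

(** * The Frobenius characteristic of a local action *)

Section LocalActionOnChains.
Variables (d : Order.disp_t) (P : finPOrderType d) (n : nat) (bot top : P).
Variables (rk : P -> nat) (to : {action {perm 'I_n} &-> maxchains P}).
Hypothesis rankedP : ranked_of_rank n bot top rk.
Hypothesis localP : local_action rk to.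

Local Notation r := (rank_elt bot rk).

Let local_r := rank_elt_local rankedP localP.
Let ext_r := rank_elt_ext rankedP.

Definition chain_blocks c : {set {set 'I_n}} :=
  [set orbit 'P 'C[c | to] x | x in [set: 'I_n]].

Lemma chain_blocks_partition c : partition (chain_blocks c) [set: 'I_n].
Proof. by apply: orbit_partition; apply/actsP => g _ x; rewrite !inE. Qed.

Lemma pblock_chain_blocks c x : pblock (chain_blocks c) x = orbit 'P 'C[c | to] x.
Proof.
apply/eqP; rewrite pblock_eqE ?orbit_refl ?imset_f //.
exact: chain_blocks_partition.
Qed.

(** Two letters of one block are related by a stabilizing permutation, so by [tperm_stab] their
    transposition stabilizes [c]; such transpositions generate the fiber-preserving permutations. *)
Lemma stab_fiber_perms c : 'C[c | to] = fiber_perms (pblock (chain_blocks c)).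
Proof.
apply/setP => g; apply/idP/fiber_permsP => [gc x|].
  by rewrite !pblock_chain_blocks; apply/eqP; rewrite orbit_eq_mem; apply: (mem_orbit 'P x gc).
have := @fiber_perm_ind _ _ (pblock (chain_blocks c)) (fun g => to c g = c).
move=> ind gP; apply/astab1P; apply: ind gP => [|u v cu cv|x y].
- exact: act1.
- by rewrite actM cu.
rewrite !pblock_chain_blocks => xy; have := orbit_refl 'P 'C[c | to] y.
rewrite -xy => /orbitP[h /astab1P hc hxy].
exact: (tperm_stab local_r ext_r hc hxy).
Qed.

Lemma stab_young c :
  'C[c | to] = young_subgroup (chain_blocks c).
Proof. by rewrite young_subgroupE ?stab_fiber_perms //; apply: chain_blocks_partition. Qed.

(** The stabilizer of c.g is the conjugate by [g], so its blocks are the images under [g] of those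
    of [c]. *)
Lemma chain_blocks_act c g :
  block_sizes (chain_blocks (to c g)) = block_sizes (chain_blocks c).
Proof.
apply/perm_sortP.
- by move=> x y; apply: leq_total.
- by move=> y x z /= yx zy; apply: leq_trans yx.
- by move=> x y; rewrite andbC -eqn_leq => /eqP.
have orbJ x : orbit 'P ('C[c | to] :^ g) (g x) = [set g y | y in orbit 'P 'C[c | to] x].
  apply/setP => y; rewrite -[y](permKV g) mem_imset; last exact: perm_inj.
  exact: (orbit_conjsg 'P _ g x (g^-1 y)).
rewrite (_ : [seq #|b| | b : {set 'I_n} <- enum (chain_blocks c)] =
  [seq #|b| | b : {set 'I_n} <-
     [seq [set g x | x in b] | b : {set 'I_n} <- enum (chain_blocks c)]]).
  apply/perm_map/uniq_perm; rewrite ?enum_uniq //.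
    by rewrite map_inj_uniq ?enum_uniq //; apply/imset_inj/perm_inj.
  move=> b; rewrite mem_enum /chain_blocks astab1_act.
  apply/imsetP/mapP => [[x _ ->]|[b']].
    exists (orbit 'P 'C[c | to] (g^-1 x)); first by rewrite mem_enum imset_f.
    by rewrite -orbJ permKV.
  rewrite mem_enum => /imsetP[x _ ->] ->; exists (g x) => //.
  by rewrite orbJ.
rewrite -map_comp; apply: eq_map => b /=; rewrite card_imset //; exact: perm_inj.
Qed.

Local Open Scope ring_scope.

(** Exchanging the sums over permutations and fixed chains, each chain contributes the power sums
    over its stabilizer, a Young subgroup. *)
Lemma frob_ch_stab :
  frob_ch (fun w => (perm_char to w)%:R) =
  \sum_c (#|'C[c | to]|%:R / n`!%:R) *: hprod n (block_sizes (chain_blocks c)).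
Proof.
rewrite /frob_ch.
rewrite (eq_bigr (fun w => \sum_(c | to c w == c) power_sum_cycle w)); last first.
  move=> w _; rewrite sumr_const scaler_nat; congr (_ *+ _).
  apply: eq_card => c; transitivity (to c w == c) => //.
  exact/afix1P/eqP.
transitivity (n`!%:R^-1 *:
    \sum_c \sum_(w : {perm 'I_n} | to c w == c) power_sum_cycle w).
  by congr (_ *: _); apply: (exchange_big_dep predT).
rewrite scaler_sumr; apply: eq_bigr => c _.
rewrite hprod_block_sizes; last exact: chain_blocks_partition.
rewrite mulrC -scalerA [in RHS]stab_fiber_perms -sum_power_sum_cycle.
congr (_ *: _); apply: eq_bigl => w; rewrite -stab_fiber_perms.
by apply/eqP/astab1P.
Qed.

Lemma frob_ch_h_positive : h_positive (frob_ch (fun w => (perm_char to w)%:R)).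
Proof.
pose type c := block_sizes (chain_blocks c).
pose U := undup [seq type c | c <- enum {: maxchains P}].
pose a c : rat := #|'C[c | to]|%:R / n`!%:R.
(* Chains are grouped by their block sizes, so that no partition is listed twice. *)
exists [seq (nu, \sum_(c | type c == nu) a c) | nu <- U]; split.
- apply/allP => _ /mapP[nu + ->]; rewrite mem_undup => /mapP[c _ ->].
  exact: (block_sizes_partition (chain_blocks_partition c)).
- by rewrite -map_comp map_id undup_uniq.
- apply/allP => _ /mapP[nu _ ->]; apply: sumr_ge0 => c _.
  by rewrite divr_ge0 ?ler0n.
rewrite frob_ch_stab big_map /=.
rewrite [RHS](eq_bigr (fun nu => \sum_(c | type c == nu) a c *: hprod n nu)).
  rewrite [RHS](exchange_big_dep predT) //=; apply: eq_bigr => c _.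
  have cU : type c \in U by rewrite mem_undup map_f // mem_enum.
  rewrite big_mkcond (bigD1_seq (type c)) ?undup_uniq //= eqxx.
  by rewrite big1 ?addr0 // => nu; rewrite eq_sym => /negPf->.
by move=> nu _; rewrite scaler_suml.
Qed.

(** * Local actions with a single orbit *)

Section SingleOrbit.
Variable nu : seq nat.
Hypothesis part_nu : is_partition n nu.
Hypothesis frobE : frob_ch (fun w => (perm_char to w)%:R) = hprod n nu.

Lemma partition_small mu : (n < 2)%N -> is_partition n mu -> mu = nseq n 1%N.
Proof.
move=> n2 /and3P[_ mu0 /eqP summu].
case: mu mu0 summu => [|a [|b mu]] /=; first by move=> _ <-.
  by rewrite andbT addn0 => a0 an; rewrite an in a0 *; case: (n) a0 n2 => [|[]].
by case/and3P => a0 b0 _; lia.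
Qed.

Lemma hprod_eval_one mu : is_partition n mu ->
  (hprod n mu).@[fun i : 'I_n => ((i : nat) == 0)%:R] = 1.
Proof.
case/and3P => _ /allP mu0 /eqP summu; rewrite /hprod rmorph_prod /=.
rewrite big_seq big1 // => k kmu; apply: hcomplete_eval_one.
rewrite -summu sumnE (big_rem k) //=; have := mu0 _ kmu; lia.
Qed.

(** Evaluating at (1, 0, 0, ...) shows that the stabilizer orders add up to n!, which the orbit of
    [c] alone already provides. *)
Lemma chain_transitive c : orbit to [set: {perm 'I_n}] c =i predT.
Proof.
have nf : n`!%:R != 0 :> rat by rewrite pnatr_eq0 -lt0n fact_gt0.
have sumC : (\sum_c #|'C[c | to]| = n`!)%N.
  have := congr1 (meval (fun i : 'I_n => ((i : nat) == 0)%:R)) frobE.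
  rewrite frob_ch_stab hprod_eval_one // raddf_sum /=.
  rewrite (eq_bigr (fun c => #|'C[c | to]|%:R / n`!%:R)) => [|c' _]; last first.
    rewrite mevalZ hprod_eval_one ?mulr1 //.
    exact/block_sizes_partition/chain_blocks_partition.
  rewrite -mulr_suml => /(canRL (mulfVK nf)); rewrite mul1r -natr_sum.
  by move/eqP; rewrite eqr_nat => /eqP.
have cardC c' : (#|orbit to setT c'| * #|'C[c' | to]| = n`!)%N.
  by rewrite -(setTI 'C[c' | to]) card_orbit_stab cardsT card_Sn.
have C0 c' : (0 < #|'C[c' | to]|)%N by apply/card_gt0P; exists 1%g; apply/astab1P/act1.
move=> c1; rewrite [RHS]inE; apply/negbNE/negP => c1c.
have := sumC; rewrite (bigID (mem (orbit to setT c))) /=.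
have -> : (\sum_(c' in orbit to setT c) #|'C[c' | to]| = n`!)%N.
  rewrite (eq_bigr (fun=> #|'C[c | to]|)) => [|c' /orbit_eqP cc'].
    by rewrite sum_nat_const cardC.
  apply/eqP; rewrite -(eqn_pmul2l (_ : 0 < #|orbit to setT c|)%N) ?cardC.
    by rewrite -cc' cardC.
  by apply/card_gt0P; exists c; apply: orbit_refl.
rewrite (bigD1 c1) //= -[RHS]addn0 => /addnI/eqP.
by rewrite addn_eq0 eqn0Ngt C0.
Qed.

Lemma block_sizes_nu c : block_sizes (chain_blocks c) = nu.
Proof.
have partc := block_sizes_partition (chain_blocks_partition c).
have [n2|n2] := ltnP n 2; first by rewrite (partition_small n2 partc) (partition_small n2 part_nu).
have hprodE : hprod n (block_sizes (chain_blocks c)) = hprod n nu.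
  rewrite -frobE frob_ch_stab (eq_bigr (fun c' => (#|'C[c' | to]|%:R / n`!%:R) *:
    hprod n (block_sizes (chain_blocks c)))) => [|c' _]; last first.
    have /orbitP[g _ <-] : c' \in orbit to setT c by rewrite chain_transitive.
    by rewrite chain_blocks_act.
  (* All chains have the same block sizes; evaluating once more at (1, 0, 0, ...) shows that their
     coefficients add up to 1. *)
  have := congr1 (meval (fun i : 'I_n => ((i : nat) == 0)%:R)) frobE.
  rewrite frob_ch_stab hprod_eval_one // raddf_sum /= -scaler_suml.
  rewrite (eq_bigr (fun c => #|'C[c | to]|%:R / n`!%:R)) => [->|c' _].
    by rewrite scale1r.
  rewrite mevalZ hprod_eval_one ?mulr1 //.
  exact/block_sizes_partition/chain_blocks_partition.
(* Taking q to be a polynomial variable over [algC] yields an identity between products of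
   q-integers, which determines the indices. *)
pose i0 : 'I_n := Ordinal (ltnW n2); pose i1 : 'I_n := Ordinal n2.
pose f : {rmorphism rat -> {poly algC}} := polyC \o ratr.
have i01 : i0 != i1 by [].
have := congr1 (mmap f (fun i => if i == i0 then 1 else if i == i1 then 'X else 0)) hprodE.
rewrite /hprod !rmorph_prod /=.
rewrite !(eq_bigr _ (fun k _ => hcomplete_mmap_two k f 'X i01)) => eqq.
have /and3P[s1 p1 _] := partc; have /and3P[s2 p2 _] := part_nu.
apply: (sorted_eq _ _ s1 s2 (qint_prod_inj p1 p2 eqq)).
  by move=> y x z /= yx zy; apply: leq_trans yx.
by move=> x y; rewrite andbC -eqn_leq => /eqP.
Qed.

(* Coordinates of poset elements by block counts *)
Local Close Scope ring_scope.
Variable c0 : maxchains P.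
Let kappa := pblock (chain_blocks c0).

Definition block_count (g : {perm 'I_n}) k b :=
  #|[set a : 'I_n | (g a < k) && (kappa a == b)]|.

Lemma card_perm_lt (g : {perm 'I_n}) k : k <= n -> #|[set a | g a < k]| = k.
Proof.
move=> kn; have -> : [set a | g a < k] = g @^-1: [set x : 'I_n | x < k].
  by apply/setP => a; rewrite !inE.
rewrite card_preimset; last exact: perm_inj.
have -> : [set x : 'I_n | x < k] = [set widen_ord kn y | y : 'I_k].
  apply/setP => x; rewrite inE; apply/idP/imsetP => [xk|[y _ ->]]; last exact: (ltn_ord y).
  by exists (Ordinal xk) => //; apply: val_inj.
rewrite card_imset ?card_ord // => y z /(congr1 val) yz; exact: val_inj.
Qed.

(** By [rank_inj] the two preimages of the first k letters differ by a stabilizing permutation of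
    [c0], which preserves blocks. *)
Lemma block_count_eq g h k : k <= n -> r k (to c0 g) = r k (to c0 h) ->
  block_count g k =1 block_count h k.
Proof.
move=> kn rgh b.
have [s /astab1P sc sk] := rank_inj local_r ext_r
  (rank_elt_mix rankedP) (chain_transitive c0) kn rgh.
have sP a : kappa (s a) = kappa a.
  by move: sc; rewrite stab_fiber_perms => /fiber_permsP; apply.
rewrite -[RHS](card_preimset _ (@perm_inj _ s)); apply: eq_card => a.
by rewrite !inE sk sP.
Qed.

(* Moving h on one side by the stabilizer of c0 and on the other by permutations
   preserving [l], one gets a single word realizing both elements. *)
Lemma block_count_le g h k l : k <= n -> l <= n ->
  (forall b, block_count g k b <= block_count h l b) ->
  (r k (to c0 g) <= r l (to c0 h))%O.
Proof.
move=> kn ln cgh; pose A := [set a | g a < k].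
have cardA : #|A| = k by rewrite card_perm_lt.
have [s sP sA] : exists2 s : {perm 'I_n}, (forall a, kappa (s a) = kappa a) &
    [set s a | a in A] \subset [set a | h a < l].
  apply: fiber_perm_subset => b; apply: leq_trans (_ : block_count g k b <= _).
    by apply/eq_leq/eq_card => a; rewrite !inE.
  by apply: leq_trans (cgh b) _; apply/eq_leq/eq_card => a; rewrite !inE.
have sc : to c0 s = c0 by apply/astab1P; rewrite stab_fiber_perms; apply/fiber_permsP.
have hsA a : a \in A -> h (s a) < l.
  by move=> aA; have := subsetP sA (s a); rewrite inE imset_f // => /(_ isT).
pose h' := (s * h)%g; have h'inj := @perm_inj _ h'.
(* [v] moves the image of [A] onto the first k letters while preserving the first l, so [h' * v]
   realizes both elements on one chain. *)
have [v vP vA] : exists2 v : {perm 'I_n}, (forall x, (v x < l) = (x < l)) &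
    [set v x | x in [set h' a | a in A]] \subset [set x : 'I_n | x < k].
  apply: (@fiber_perm_subset _ _ (fun x : 'I_n => x < l)) => -[].
    apply: leq_trans (_ : k <= _).
      rewrite -cardA -(card_imset A h'inj) subset_leq_card //.
      by apply/subsetP => x; rewrite inE => /andP[].
    have kl : k <= l.
      rewrite -cardA -(card_imset A h'inj) -(card_perm_lt 1 ln) subset_leq_card //.
      by apply/subsetP => _ /imsetP[a aA ->]; rewrite inE perm1 permM hsA.
    rewrite -[leqLHS](card_perm_lt 1 kn) subset_leq_card //; apply/subsetP => x.
    by rewrite !inE perm1 => xk; rewrite xk (leq_trans xk kl).
  rewrite (_ : [set x in _ | _] = set0) ?cards0 //; apply/setP => x; rewrite !inE.
  by apply/andP => -[/imsetP[a aA ->]]; rewrite permM hsA.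
have eqA : [set a | (h' * v)%g a < k] = A.
  apply/esym/eqP; rewrite eqEcard cardA card_perm_lt // leqnn andbT.
  apply/subsetP => a aA; rewrite inE permM.
  by have := subsetP vA (v (h' a)); rewrite inE !imset_f // => /(_ isT).
have -> : r k (to c0 g) = r k (to c0 (h' * v)%g).
  apply: (rank_eq local_r) => a.
  by have /setP/(_ a) := eqA; rewrite !inE => ->.
have -> : r l (to c0 h) = r l (to c0 (h' * v)%g).
  by rewrite !actM sc; apply/esym/(rank_stable local_r).
apply: (rank_elt_le rankedP).
rewrite ln andbT -cardA -(card_imset A h'inj) -(card_perm_lt 1 ln) subset_leq_card //.
by apply/subsetP => _ /imsetP[a aA ->]; rewrite inE perm1 permM hsA.
Qed.

Lemma exists_word x : exists g : {perm 'I_n}, r (rk x) (to c0 g) == x.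
Proof.
have [c [cx _]] := rank_elt_cover rankedP (lexx x).
have /orbitP[g _ gc] : c \in orbit to setT c0 by rewrite chain_transitive.
by exists g; rewrite gc cx.
Qed.

(** The chosen permutation is immaterial, by [block_count_eq]. *)
Definition coord x b := block_count (xchoose (exists_word x)) (rk x) b.

Lemma coordE g x b : r (rk x) (to c0 g) = x -> coord x b = block_count g (rk x) b.
Proof.
move=> gx; apply: block_count_eq; first exact: (rk_max rankedP).
by rewrite (eqP (xchooseP (exists_word x))).
Qed.

(** On a chain through both elements, the preimage of the first [rk x] letters lies in that of the
    first [rk y]; the converse is [block_count_le]. *)
Lemma coord_leP x y : reflect (forall b, coord x b <= coord y b) (x <= y)%O.
Proof.
apply: (iffP idP) => [xy b|le_xy]; last first.
  rewrite -(eqP (xchooseP (exists_word x))) -(eqP (xchooseP (exists_word y))).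
  by apply: block_count_le le_xy; apply: (rk_max rankedP).
have [c [cx cy]] := rank_elt_cover rankedP xy.
have /orbitP[g _ gc] : c \in orbit to setT c0 by rewrite chain_transitive.
rewrite -gc in cx cy; rewrite (coordE _ cx) (coordE _ cy) subset_leq_card //.
apply/subsetP => a; rewrite !inE => /andP[ga ->]; rewrite andbT.
exact: leq_trans ga (rk_le rankedP xy).
Qed.

(** Blocks in weakly decreasing order of size, so that the j-th block matches the j-th part of
    [nu]. *)
Let bs := sort (relpre (fun b : {set 'I_n} => #|b|) geq) (enum (chain_blocks c0)).

Lemma nu_bs : nu = [seq #|b| | b : {set 'I_n} <- bs].
Proof. by rewrite -(block_sizes_nu c0) /block_sizes sort_map. Qed.

Lemma size_nu : size nu = size bs.
Proof. by rewrite nu_bs size_map. Qed.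

Lemma nth_nu i : i < size nu -> nth 0 nu i = #|nth set0 bs i|.
Proof. by rewrite nu_bs size_map => ibs; rewrite (nth_map set0). Qed.

Lemma mem_bs b : (b \in bs) = (b \in chain_blocks c0).
Proof. by rewrite mem_sort mem_enum. Qed.

Lemma uniq_bs : uniq bs.
Proof. by rewrite sort_uniq enum_uniq. Qed.

Lemma kappaE a b : b \in chain_blocks c0 -> (kappa a == b) = (a \in b).
Proof. by apply: pblock_eqE; apply: chain_blocks_partition. Qed.

Lemma coord_bound x (j : 'I_(size nu)) : coord x (nth set0 bs j) < (nth 0 nu j).+1.
Proof.
have jbs : j < size bs by rewrite -size_nu.
rewrite ltnS nth_nu // subset_leq_card //; apply/subsetP => a.
by rewrite inE kappaE -?mem_bs ?mem_nth // => /andP[].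
Qed.

Lemma coord_out x b : b \notin bs -> coord x b = 0.
Proof.
rewrite mem_bs => bB; apply/eqP; rewrite cards_eq0; apply/eqP/setP => a.
rewrite !inE; apply/andP => -[_ /eqP ab]; case/negP: bB; rewrite -ab.
by apply: pblock_memT; apply: chain_blocks_partition.
Qed.

(** Choose [q b] letters in each block [b], and let [A] be their union. A permutation carrying [A]
    to the first letters yields a chain whose element of rank [#|A|] has the wanted coordinates. *)
Lemma coord_surj (q : {set 'I_n} -> nat) : (forall b, b \in bs -> q b <= #|b|) ->
  exists x, forall b, b \in bs -> coord x b = q b.
Proof.
move=> qb; pose F (b : {set 'I_n}) := [set a in take (q b) (enum b)].
pose A := [set a | a \in F (kappa a)].
have cardF b : b \in bs -> #|F b| = q b.
  move=> /qb qle; rewrite cardsE (card_uniqP _) ?take_uniq ?enum_uniq //.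
  by rewrite size_take_min -cardE (minn_idPl qle).
have An : #|A| <= n by rewrite -[leqRHS]card_ord max_card.
(* With a single fiber, the matching lemma only compares cardinalities. *)
have [|g _ gA] := @fiber_perm_subset _ _ (fun _ : 'I_n => tt) A
  [set x : 'I_n | x < #|A|].
  move=> []; apply: leq_trans (_ : #|A| <= _).
    by apply: subset_leq_card; apply/subsetP => a; rewrite inE => /andP[].
  rewrite -[leqLHS](card_perm_lt 1 An); apply: subset_leq_card; apply/subsetP => a.
  by rewrite !inE perm1 => ->.
have gAE : [set a | g a < #|A|] = A.
  apply/esym/eqP; rewrite eqEcard card_perm_lt // leqnn andbT; apply/subsetP => a aA.
  by have := subsetP gA (g a); rewrite !inE imset_f // => /(_ isT).
pose x := r #|A| (to c0 g); have [_ rx] := rank_eltP rankedP (to c0 g) An.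
exists x => b bB; rewrite (@coordE g) /x rx // -cardF //; apply: eq_card => a.
have /setP/(_ a) := gAE; rewrite !inE => ->.
have [->|ab] := eqVneq (kappa a) b; rewrite ?andbT ?andbF //.
apply/esym/negbTE; apply: contra ab => /mem_take; rewrite mem_enum.
by rewrite -kappaE -?mem_bs.
Qed.

Lemma single_orbit_iso : iso_to_chain_product P nu.
Proof.
pose f x : chain_product nu := [ffun j => Ordinal (coord_bound x j)].
have fE x j : val (f x j) = coord x (nth set0 bs j) by rewrite /f ffunE.
have leE x y : (x <= y)%O = [forall j, f x j <= f y j].
  apply/coord_leP/forallP => H; first by move=> j; rewrite !fE.
  move=> b; have [bB|bB] := boolP (b \in bs); last by rewrite coord_out.
  have jlt : index b bs < size nu by rewrite nu_bs size_map index_mem.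
  by have := H (Ordinal jlt); rewrite !fE /= nth_index.
exists f; split=> //.
have finj : injective f.
  by move=> x y fxy; apply/le_anti; rewrite !leE fxy andbb; apply/forallP => j.
have fsurj p : exists x, f x == p.
  (* A set that is not a block has an index out of range and receives the default 0. *)
  pose q b := if insub (index b bs) is Some j then val (p j) else 0.
  have [b bB|x xq] := @coord_surj q.
    rewrite /q; case: insubP => [j jlt ij|//].
    rewrite -ltnS; apply: leq_trans (ltn_ord (p j)) _.
    by rewrite ltnS nth_nu // ij nth_index.
  exists x; apply/eqP/ffunP => j; apply: val_inj; rewrite fE.
  have jbs : j < size bs by rewrite -size_nu.
  rewrite xq ?mem_nth // /q index_uniq ?uniq_bs //.
  by rewrite insubT //= => jlt; congr (nat_of_ord (p _)); apply: val_inj.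
exists (fun p => xchoose (fsurj p)) => [x|p]; last exact/eqP/(xchooseP (fsurj p)).
exact/finj/eqP/(xchooseP (fsurj (f x))).
Qed.

End SingleOrbit.
End LocalActionOnChains.

Theorem theorem4p3 (d : Order.disp_t) (P : finPOrderType d) (n : nat)
    (bot top : P) (rk : P -> nat)
    (to : {action {perm 'I_n} &-> maxchains P}) :
  ranked_of_rank n bot top rk ->
  local_action rk to ->
  [/\ (forall c : maxchains P, exists B : {set {set 'I_n}},
          partition B [set: 'I_n] /\ ('C[c | to])%g = young_subgroup B),
      h_positive (frob_ch (fun w => (perm_char to w)%:R%R))
    & forall nu : seq nat, is_partition n nu ->
        frob_ch (fun w => (perm_char to w)%:R%R) = hprod n nu ->
        iso_to_chain_product P nu].
Proof.
move=> rankedP localP; split=> [c||nu part_nu frobE].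
- exists (chain_blocks to c); split; first exact: chain_blocks_partition.
  exact: (stab_young rankedP localP).
- exact: (frob_ch_h_positive rankedP localP).
(* The empty chain extends to a maximal one, which serves as the base chain. *)
have [|c _] := @extend_maxchain _ P set0; first by apply/is_chainP => x; rewrite inE.
exact: (single_orbit_iso rankedP localP part_nu frobE c).
Qed.
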